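(* Let $q$ be a positive integer and suppose $i\in P\subseteq[q]$. Let $$W_{P,i}=\{2\mathbf e_i+\mathbf e_j : j\in P\setminus\{i\}\}\cup\{\mathbf e_j+\mathbf e_k+\mathbf e_l : j<k<l\le q,\ j,k,l\in[q]\setminus P\}\cup\{\mathbf e_i+\mathbf e_j+\mathbf e_k : 1\le j<k\le q,\ i\notin\{j,k\}\}.$$ Then: (1) if $|P|=1$, then $W_{P,i}=\mathcal{U}^3_q$ (which is a facet of $\mathbb{S}^3_q$ when $q\ge4$); (2) if $2\le|P|\le q-3$, then $W_{P,i}$ is a facet of $\mathbb{S}^3_q$ that is not in $\mathbb{U}^3_q$; (3) if $|P|>q-3$, then $W_{P,i}$ is a face of $\mathbb{S}^3_q$ contained in $\mathcal{U}^3_{\mathbf e_i}$ (which is a facet of $\mathbb{S}^3_q$ when $q\ge3$). Moreover, if $W_{P,i}=W_{Q,j}$ with $i\in P\subseteq [q]$, $j\in Q\subseteq[q]$ and $2\le|P|,|Q|\le q-3$, then $P=Q$ and $i=j$.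
   Context: Let $\mathsf{k}$ be a field, $[q]=\{1,\dots,q\}$, $\mathbf e_i$ the $i$-th standard unit vector of $\mathbb{R}^q$, $|\mathbf a|=a_1+\cdots+a_q$, and $\mathcal{N}^r_q=\{\mathbf a\in\mathbb{N}^q : |\mathbf a|=r\}$. The $q$-extremal ideal $\mathcal{E}_q$ is the ideal of $\mathsf{k}[x_A : \emptyset\ne A\subseteq[q]]$ generated by $\epsilon_i=\prod_{A\ni i}x_A$, $i\in[q]$. Its power $\mathcal{E}_q^{\,r}$ is minimally generated by the monomials $\epsilon^{\mathbf a}=\epsilon_1^{a_1}\cdots\epsilon_q^{a_q}$, $\mathbf a\in\mathcal{N}^r_q$. Each set $\sigma\subseteq\mathcal{N}^r_q$ is labeled by $\mathbf{m}_\sigma=\mathrm{lcm}(\epsilon^{\mathbf a}:\mathbf a\in\sigma)$ (with $\mathbf m_\emptyset=1$). The Scarf complex $\mathbb{S}^r_q$ of $\mathcal{E}_q^{\,r}$ is the simplicial complex on $\mathcal{N}^r_q$ consisting of all $\sigma\subseteq\mathcal{N}^r_q$ with $\mathbf{m}_\sigma\ne\mathbf{m}_\tau$ for every $\tau\subseteq\mathcal{N}^r_q$, $\tau\neq\sigma$ (the empty set is a face). For $\mathbf a\in\mathbb{N}^q$, $\mathcal{U}^r_{\mathbf a}=\{\mathbf c\in\mathcal{N}^r_q : a_i\le c_i\le a_i+1\text{ for all }i\in[q]\}$, and $\mathcal{U}^r_q=\mathcal{U}^r_{\mathbf 0}$ is the set of $0/1$ vectors in $\mathcal{N}^r_q$.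 $\mathbb{U}^r_q$ is the simplicial complex generated by the sets $\mathcal{U}^r_{\mathbf a}$ with $\mathbf a\in\mathbb{N}^q$, $r-q<|\mathbf a|<r$. *)

(* Defs.v *)
From mathcomp Require Import all_boot all_order all_algebra.
From mathcomp Require Import mpoly.

Set Implicit Arguments.
Unset Strict Implicit.
Unset Printing Implicit Defensive.

Local Open Scope ring_scope.

(* [q] is represented by 'I_q = {0, ..., q-1}, vectors of N^q by 'X_{1..q}
   (so |a| is mdeg a and e_i is U_(i)%MM), and subsets of N^r_q by subsets of
   the finite type 'X_{1..q < r.+1} of vectors a with |a| <= r. *)

Notation nonempty_subset q := {A : {set 'I_q} | A != set0}.

Section ExtremalMonomials.
Variables (k : fieldType) (q : nat).

Definition nvars : nat := #|{: nonempty_subset q}|.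

Definition xvar (A : nonempty_subset q) : {mpoly k[nvars]} := 'X_(enum_rank A).

Definition eps (i : 'I_q) : {mpoly k[nvars]} :=
  \prod_(A : nonempty_subset q | i \in val A) xvar A.

Definition eps_pow (a : 'X_{1..q}) : {mpoly k[nvars]} :=
  \prod_(i < q) eps i ^+ a i.

(* eps_pow a is a monomial with coefficient 1, so mlead returns its exponent
   vector; mlcm is the lcm of monomials given by their exponent vectors. *)
Definition lcm_label (r : nat) (s : {set 'X_{1..q < r.+1}}) : {mpoly k[nvars]} :=
  'X_[\big[@mlcm nvars/0%MM]_(a in s) mlead (eps_pow a)].

End ExtremalMonomials.

Section Complexes.
Variables (q r : nat).
Implicit Types (s t : {set 'X_{1..q < r.+1}}).

Definition Nset : {set 'X_{1..q < r.+1}} :=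
  [set c : 'X_{1..q < r.+1} | mdeg c == r].

Definition scarf (k : fieldType) : {set {set 'X_{1..q < r.+1}}} :=
  [set s in powerset Nset |
    [forall t in powerset Nset, (t != s) ==> (lcm_label k s != lcm_label k t)]].

Definition Uset (a : 'X_{1..q}) : {set 'X_{1..q < r.+1}} :=
  [set c in Nset | [forall i : 'I_q, (a i <= c i <= (a i).+1)%N]].

(* The bound |a| < r is carried by the type of a. *)
Definition Ucomplex : {set {set 'X_{1..q < r.+1}}} :=
  [set s : {set 'X_{1..q < r.+1}} |
    [exists a : 'X_{1..q < r}, (r < mdeg a + q)%N && (s \subset Uset a)]].

Definition facet (K : {set {set 'X_{1..q < r.+1}}}) s : bool :=
  maxset (fun t => t \in K) s.

End Complexes.

Definition Wset (q : nat) (P : {set 'I_q}) (i : 'I_q) : {set 'X_{1..q < 4}} :=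
  [set c : 'X_{1..q < 4} |
     [exists j in P :\ i, (c : 'X_{1..q}) == (U_(i) *+ 2 + U_(j))%MM]]
  :|: [set c : 'X_{1..q < 4} |
     [exists j : 'I_q, exists k : 'I_q, exists l : 'I_q,
       [&& (j < k < l)%N, j \notin P, k \notin P, l \notin P
         & (c : 'X_{1..q}) == (U_(j) + U_(k) + U_(l))%MM]]]
  :|: [set c : 'X_{1..q < 4} |
     [exists j : 'I_q, exists k : 'I_q,
       [&& (j < k)%N, i != j, i != k
         & (c : 'X_{1..q}) == (U_(i) + U_(j) + U_(k))%MM]]].

(* Main.v *)
Require Import Defs.
From mathcomp Require Import all_boot all_order all_algebra.
From mathcomp Require Import mpoly.
From mathcomp Require Import zify.

Set Implicit Arguments.
Unset Strict Implicit.
Unset Printing Implicit Defensive.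

(** The exponent of x_A in epsilon^a is the weight of a on A, the sum of the
a_i for i in A ([eps_expoE]); so the label of a set s is the function
sending A to the largest weight on A of an element of s.  Adding a vertex a to
s, or removing it, keeps the label exactly when on every A some other element
of s is at least as heavy as a, or a has weight 0.  Hence s is a Scarf face if
and only if every vertex a, in s or not, has positive weight on some A where it
is strictly heavier than all elements of s other than a ([scarfP], [exposedP]);
call a exposed by such an A.

For r = 3 every vertex is e_j + e_k + e_l, and its weight on A is the number of
indices j, k, l that lie in A.  Every vertex, whether it belongs to W_{P,i} or
not, is exposed by an explicit A with at most three elements, so W_{P,i} is
always a face ([Wset_scarf]).

For maximality let b be a vertex outside W = W_{P,i}.  It is enough to find a
in W such that every A exposing a in W satisfies wt a A <= wt b A: then no
face contains b and W, as a would not be exposed ([scarf_facet]).  There is such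
an a because the vertices of W that differ from a in a single index restrict the
sets A that expose a:
  - if j is in P, comparing e_i + e_j + e_m with 2e_i + e_j shows that an
    exposing A contains m and not i ([exposing_through]);
  - if j and l are outside P, which misses at least three indices, an exposing
    A for e_i + e_j + e_l contains i, j and l ([exposing_outside]).
This settles all b when P misses at least three indices, and also when P is
the whole of [q] with q >= 3 ([Wset_facet]).

The sets U^3_q and U^3_{e_i} are W_{P,i} for the extreme choices P = {i} and
P = [q], so all the assertions on faces and facets are instances of these two
facts.  When 2 <= |P| <= q - 3, W_{P,i} has vertices with i-th coordinate 2 and 0,
so it fits in no U^3_a; and its vertices of the form 2e_x + e_y with x <> y are
those with x = i and y in P minus i, from which i and P can be read off. *)

(** * Labels as weight functions *)

Definition wt q (a : 'X_{1..q}) (A : {set 'I_q}) : nat := \sum_(i in A) a i.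

Section Labels.
Variables (k : fieldType) (q r : nat).
Implicit Types (a : 'X_{1..q}) (A : {set 'I_q}) (s t : {set 'X_{1..q < r.+1}}).

(** The exponent vector of the monomial epsilon^a. *)
Definition eps_expo a : 'X_{1..nvars q} :=
  (\sum_i (\sum_(A : nonempty_subset q | i \in val A) U_(enum_rank A)) *+ a i)%MM.

Lemma eps_powE a : eps_pow k a = 'X_[eps_expo a]%R.
Proof.
rewrite /eps_pow /eps_expo -mprodXE; apply: eq_bigr => i _.
by rewrite -mpolyXn -mprodXE.
Qed.

Lemma eps_expoE a (A : nonempty_subset q) :
  eps_expo a (enum_rank A) = wt a (val A).
Proof.
rewrite /eps_expo /wt mnm_sumE [RHS]big_mkcond /=; apply: eq_bigr => i _.
rewrite mulmnE mnm_sumE; case: ifP => iA.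
  rewrite (bigD1 A) //= mnm1E eqxx big1 ?addn0 ?mul1n // => B /andP[_ nBA].
  by rewrite mnm1E (inj_eq enum_rank_inj) (negbTE nBA).
rewrite big1 ?mul0n // => B iB; rewrite mnm1E (inj_eq enum_rank_inj).
by case: eqP => // BA; rewrite -BA iB in iA.
Qed.

Lemma lcm_label_eq s t :
  lcm_label k s = lcm_label k t <->
  forall A, \max_(a in s) wt a A = \max_(a in t) wt a A.
Proof.
have expoE (u : {set 'X_{1..q < r.+1}}) (A : nonempty_subset q) :
    (\big[@mlcm _/0%MM]_(a in u) mlead (eps_pow k a)) (enum_rank A)
    = \max_(a in u) wt a (val A).
  apply: (big_ind2 (fun (m : 'X_{1..nvars q}) n => m (enum_rank A) = n)).
  - by rewrite mnm0E.
  - by move=> m n m' n' <- <-; rewrite mnmE.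
  - by move=> a _; rewrite eps_powE mleadXm eps_expoE.
split=> [eq_st A | eq_st].
  have [-> | nzA] := eqVneq A set0.
    by rewrite !big1 // => a _; rewrite /wt big_set0.
  have eq_expo := congr1 (@mlead _ _) eq_st; rewrite /lcm_label !mleadXm in eq_expo.
  by rewrite -(expoE s (Sub A nzA)) eq_expo expoE.
congr ('X_[_])%R; apply/mnmP => v.
by rewrite -(enum_valK v) !expoE eq_st.
Qed.

(** * Faces and facets of the Scarf complex via exposing sets *)

(** Among a and the elements of s, the indicator of A as a linear functional is
maximal at a alone; a itself may lie outside s. *)
Definition exposes A s (a : 'X_{1..q < r.+1}) : Prop :=
  forall b, b \in s -> b != a -> wt b A < wt a A.

(** Stated with a maximum, whose value on an empty set is 0, so that the
label 1 of the empty set needs no separate treatment. *)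
Definition exposed s (a : 'X_{1..q < r.+1}) : Prop :=
  exists A, \max_(b in s :\ a) wt b A < wt a A.

Lemma wt_leq_max s (a : 'X_{1..q < r.+1}) A :
  a \in s -> wt a A <= \max_(b in s) wt b A.
Proof. by move=> sa; apply: (bigmax_sup a). Qed.

Lemma exposedP s (a : 'X_{1..q < r.+1}) :
  exposed s a <->
  exists2 A, 0 < wt a A & exposes A s a.
Proof.
split=> [[A ltA] | [A A_gt0 ltA]]; exists A.
- exact: leq_ltn_trans ltA.
- move=> b sb nba; apply: leq_ltn_trans ltA.
  by apply: wt_leq_max; rewrite !inE nba.
rewrite -(prednK A_gt0) ltnS; apply/bigmax_leqP => b.
by rewrite !inE -ltnS (prednK A_gt0) => /andP[nba sb]; apply: ltA.
Qed.

(** One of s :\ a and a |: s is s itself, so a Scarf face must tell these two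
sets apart on some A, which says that A exposes a.  Conversely, let t have the
label of s: a vertex of t outside s would exceed that label on the set that
exposes it, so t is contained in s; and t cannot omit a vertex a of s, since
the label of s :\ a is too small on the set exposing a. *)
Lemma scarfP s :
  reflect (s \subset Nset q r /\ forall a : 'X_{1..q < r.+1}, a \in Nset q r -> exposed s a)
          (s \in scarf q r k).
Proof.
have sub_max (u v : {set 'X_{1..q < r.+1}}) A :
    u \subset v -> \max_(b in u) wt b A <= \max_(b in v) wt b A.
  by move=> /subsetP uv; apply/bigmax_leqP => b /uv; apply: wt_leq_max.
rewrite inE powersetE; apply: (iffP andP) => -[sN sP]; split=> //.
  move=> a Na; pose u := if a \in s then s :\ a else a |: s.
  have us : u != s.
    rewrite /u; case: ifP => sa; apply/eqP => /setP/(_ a).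
      by rewrite sa setD11.
    by rewrite sa setU11.
  have uN : u \in powerset (Nset q r).
    rewrite powersetE /u; case: ifP => sa.
      exact: subset_trans (subD1set s a) sN.
    by rewrite subUset sub1set Na.
  have /existsP[A neA] :
      [exists A, \max_(b in s :\ a) wt b A != \max_(b in a |: s) wt b A].
    rewrite -[X in is_true X]negbK negb_exists; apply/negP => /forallP eqA.
    have /lcm_label_eq eqL A :
        \max_(b in s :\ a) wt b A = \max_(b in a |: s) wt b A.
      by apply/eqP; rewrite -[_ == _]negbK; apply: eqA.
    have /implyP/(_ us) := forall_inP sP u uN.
    rewrite /u; case: ifP => sa.
      by rewrite eqL (setUidPr _) ?sub1set ?eqxx.
    by rewrite -eqL (setDidPl _) ?eqxx // disjoint_sym disjoints1 sa.
  exists A; rewrite ltnNge; apply: contra neA => leA.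
  rewrite eqn_leq; apply/andP; split.
    by apply: sub_max; apply: subset_trans (subD1set s a) (subsetUr _ s).
  apply/bigmax_leqP => b; have [-> // | nba] := eqVneq b a.
  by rewrite !inE (negPf nba) /= => sb; apply: wt_leq_max; rewrite !inE nba.
apply/forall_inP => t; rewrite powersetE => tN; apply/implyP.
apply: contra => /eqP/lcm_label_eq eq_st.
have ts : t \subset s.
  apply/subsetP => a ta; case sa: (a \in s) => //.
  have [A] := sP a (subsetP tN a ta).
  rewrite (setDidPl _); last by rewrite disjoint_sym disjoints1 sa.
  by rewrite eq_st ltnNge wt_leq_max.
rewrite eqEsubset ts; apply/subsetP => a sa; case ta: (a \in t) => //.
have [A] := sP a (subsetP sN a sa); rewrite ltnNge => /negP[].
apply: leq_trans (wt_leq_max A sa) _; rewrite eq_st; apply: sub_max.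
by rewrite subsetD1 ts ta.
Qed.

(** Exposing a becomes harder in larger sets.  If no A that exposes a in s
gives a more weight than b, then a is not exposed in any set that contains s
and b. *)
Lemma scarf_facet s : s \in scarf q r k ->
  (forall b, b \in Nset q r -> b \notin s ->
     exists2 a, a \in s & forall A, exposes A s a -> wt a A <= wt b A) ->
  facet (scarf q r k) s.
Proof.
move=> sS blocked; apply/maxsetP; split=> // t tS st.
apply/eqP; rewrite eqEsubset st andbT; apply/subsetP => b tb.
have /scarfP[tN tE] := tS; apply/negPn/negP => nsb.
have [a sa dom_a] := blocked b (subsetP tN b tb) nsb.
have ta := subsetP st a sa.
have /exposedP[A _ ltA] := tE a (subsetP tN a ta).
have := dom_a A (fun c sc => ltA c (subsetP st c sc)).
by rewrite leqNgt ltA //; apply: contraNneq nsb => ->.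
Qed.
End Labels.

(** * Vertices of degree three and membership in the sets W *)

Section Triples.
Variable q : nat.
Implicit Types (i j k l x y z : 'I_q) (A P Q : {set 'I_q}).

Fact tri_subproof j k l : mdeg (U_(j) + U_(k) + U_(l))%MM < 4.
Proof. by rewrite !mdegD !mdeg1. Qed.

Definition tri j k l : 'X_{1..q < 4} := BMultinom (tri_subproof j k l).

Lemma triE j k l x : tri j k l x = (j == x) + (k == x) + (l == x).
Proof. by rewrite !mnmDE !mnm1E. Qed.

Lemma wt_tri j k l A :
  wt (tri j k l) A = (j \in A) + (k \in A) + (l \in A).
Proof.
have sum_eq x : \sum_(y in A) (x == y : nat) = (x \in A).
  have neq0 (y : 'I_q) : y != x -> (x == y : nat) = 0.
    by rewrite eq_sym => /negPf->.
  have [xA | xA] := boolP (x \in A).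
    by rewrite (bigD1 x) //= eqxx big1 // => y /andP[_ /neq0].
  by rewrite big1 // => y yA; apply: neq0; apply: contraNneq xA => <-.
rewrite /wt; under eq_bigr do rewrite triE.
by rewrite !big_split /= !sum_eq.
Qed.

Lemma tri_in_Nset j k l : tri j k l \in Nset q 3.
Proof. by rewrite inE !mdegD !mdeg1. Qed.

Lemma NsetP (c : 'X_{1..q < 4}) :
  reflect (exists j k l, c = tri j k l) (c \in Nset q 3).
Proof.
apply: (iffP idP) => [|[j [k [l ->]]]]; last exact: tri_in_Nset.
have split_var n (m : 'X_{1..q}) : mdeg m = n.+1 ->
    exists j, exists2 m', mdeg m' = n & m = (m' + U_(j))%MM.
  move=> dm; have /existsP[j mj] : [exists j, 0 < m j].
    rewrite -[X in is_true X]negbK negb_exists; apply/negP => /forallP m0.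
    move: dm; rewrite mdegE big1 // => x _; apply/eqP.
    by rewrite -leqn0 leqNgt m0.
  have Um : (U_(j) <= m)%MM by rewrite lep1mP -lt0n.
  exists j, (m - U_(j))%MM; last by rewrite submK.
  by have := congr1 (@mdeg _) (submK Um); rewrite mdegD mdeg1 dm addn1 => -[].
rewrite inE => /eqP /split_var[l [m2 /split_var[k [m1 /eqP/mdeg1P[j /eqP ->] ->]]]] cE.
by exists j, k, l; apply: val_inj; rewrite /= cE.
Qed.

Lemma triC j k l : tri j k l = tri k j l.
Proof. by apply: val_inj; rewrite /= (addmC U_(j)%MM). Qed.

Lemma triAC j k l : tri j k l = tri j l k.
Proof. by apply: val_inj; rewrite /= -!addmA (addmC U_(k)%MM). Qed.

(** The indices here are pairwise distinct instead of increasing, so that they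
can be permuted freely. *)
Variant Wspec P i : 'X_{1..q < 4} -> Prop :=
| Wdouble j of j \in P & j != i : Wspec P i (tri i i j)
| Woutside j k l of j \notin P & k \notin P & l \notin P
    & j != k & j != l & k != l : Wspec P i (tri j k l)
| Wthrough j k of i != j & i != k & j != k : Wspec P i (tri i j k).

Lemma WsetP P i c : c \in Wset P i <-> Wspec P i c.
Proof.
rewrite !inE; split.
  case/orP => [/orP[] |].
  - case/exists_inP => j; rewrite !inE => /andP[ji jP] /eqP cE.
    suff -> : c = tri i i j by apply: Wdouble.
    by apply: val_inj; rewrite /= cE mulmS mulm1n.
  - case/existsP => j /existsP[k /existsP[l /and5P[/andP[jk kl] jP kP lP /eqP cE]]].
    suff -> : c = tri j k l by apply: Woutside => //; rewrite -val_eqE /=; lia.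
    exact: val_inj.
  - case/existsP => j /existsP[k /and4P[jk ij ik /eqP cE]].
    suff -> : c = tri i j k by apply: Wthrough => //; rewrite -val_eqE /=; lia.
    exact: val_inj.
case=> [j jP ji | j k l jP kP lP njk njl nkl | j k ij ik jk].
- apply/orP; left; apply/orP; left; apply/exists_inP; exists j.
    by rewrite !inE ji.
  by rewrite /= mulmS mulm1n.
- have sorted_in (x y z : 'I_q) : x < y < z ->
      x \notin P -> y \notin P -> z \notin P ->
      [exists j : 'I_q, exists k : 'I_q, exists l : 'I_q,
        [&& j < k < l, j \notin P, k \notin P, l \notin P
          & (tri x y z : 'X_{1..q}) == (U_(j) + U_(k) + U_(l))%MM]].
    move=> lt_xyz xP yP zP; apply/existsP; exists x; apply/existsP; exists y.
    by apply/existsP; exists z; rewrite lt_xyz xP yP zP /=.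
  have dist : [&& j != k :> nat, j != l :> nat & k != l :> nat].
    by rewrite njk njl nkl.
  apply/orP; left; apply/orP; right.
  have [lt_jk|lt_kj|eq_jk] := ltngtP j k; last by lia.
    have [lt_kl|lt_lk|eq_kl] := ltngtP k l; last by lia.
      by apply: sorted_in => //; lia.
    have [lt_jl|lt_lj|eq_jl] := ltngtP j l; last by lia.
      by rewrite triAC; apply: sorted_in => //; lia.
    by rewrite triAC triC; apply: sorted_in => //; lia.
  have [lt_jl|lt_lj|eq_jl] := ltngtP j l; last by lia.
    by rewrite triC; apply: sorted_in => //; lia.
  have [lt_kl|lt_lk|eq_kl] := ltngtP k l; last by lia.
    by rewrite triC triAC; apply: sorted_in => //; lia.
  by rewrite triAC triC triAC; apply: sorted_in => //; lia.
- have sorted_in (a b : 'I_q) : a < b -> i != a -> i != b ->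
      [exists j : 'I_q, exists k : 'I_q, [&& j < k, i != j, i != k
        & (tri i a b : 'X_{1..q}) == (U_(i) + U_(j) + U_(k))%MM]].
    move=> lt_ab ia ib; apply/existsP; exists a; apply/existsP; exists b.
    by rewrite lt_ab ia ib /=.
  apply/orP; right; move: jk; rewrite -val_eqE neq_ltn => /orP[jk | kj].
    exact: sorted_in.
  by rewrite triAC; apply: sorted_in.
Qed.

(** A case split by the reason why a vertex is outside W.  The vertices 3e_j
need no case of their own: they are Square, or Excess for j = i. *)
Variant notW_spec P i : 'X_{1..q < 4} -> Prop :=
| Square j k of j != i : notW_spec P i (tri j j k)
| Excess k of (k == i) || (k \notin P) : notW_spec P i (tri i i k)
| Mixed x k l of x \in P & x != i & k != i & l != i
    & x != k & x != l & k != l : notW_spec P i (tri x k l).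

Lemma notWP P i c : i \in P -> c \in Nset q 3 -> c \notin Wset P i ->
  notW_spec P i c.
Proof.
move=> iP /NsetP[x [y [z ->]]]; move/negP; rewrite WsetP => nW.
have square j k : ~ Wspec P i (tri j j k) -> notW_spec P i (tri j j k).
  have [-> | ji] := eqVneq j i; last by constructor.
  move=> nWj; apply: Excess; have [// | ki] := eqVneq k i.
  by apply/negP => kP; apply: nWj; constructor.
have [exy | nxy] := eqVneq x y; first by rewrite exy in nW *; apply: square.
have [exz | nxz] := eqVneq x z; first by rewrite exz triAC in nW *; apply: square.
have [eyz | nyz] := eqVneq y z.
  by rewrite eyz triC triAC in nW *; apply: square.
have nxi : x != i.
  by apply/eqP => xi; apply: nW; rewrite xi; apply: Wthrough; rewrite -?xi.
have nyi : y != i.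
  by apply/eqP => yi; apply: nW; rewrite yi triC; apply: Wthrough; rewrite -?yi // eq_sym.
have nzi : z != i.
  apply/eqP => zi; apply: nW; rewrite zi triAC triC.
  by apply: Wthrough; rewrite -?zi // eq_sym.
have [xP | nxP] := boolP (x \in P); first by constructor.
have [yP | nyP] := boolP (y \in P).
  by rewrite triC; constructor; rewrite // eq_sym.
have [zP | nzP] := boolP (z \in P).
  by rewrite triAC triC; constructor; rewrite // eq_sym.
by case: nW; constructor.
Qed.

(** In this form the assumption that two vertices differ can be used by a case
analysis on equalities of indices. *)
Lemma tri_neq j k l j' k' l' : tri j k l != tri j' k' l' ->
  ~~ [|| [&& j == j', k == k' & l == l'], [&& j == j', k == l' & l == k'],
         [&& j == k', k == j' & l == l'], [&& j == k', k == l' & l == j'],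
         [&& j == l', k == j' & l == k'] | [&& j == l', k == k' & l == j']].
Proof.
apply: contra; case/or3P=> [|| /or4P[]] /and3P[/eqP-> /eqP-> /eqP->] //.
- by rewrite triAC.
- by rewrite triC.
- by rewrite triAC triC.
- by rewrite triC triAC.
by rewrite triC triAC triC.
Qed.

Lemma diff_at (a b : 'X_{1..q < 4}) x : a x != b x -> a != b.
Proof. by apply: contraNneq => ->. Qed.

Lemma mem_neq P x y : x \in P -> y \notin P -> x != y.
Proof. by move=> xP yP; apply: contraNneq yP => <-. Qed.

End Triples.

(** * Deciding weight comparisons by cases on equalities of indices *)

(** The case analysis only sees equalities between indices, so what is known
about membership in P or about distinct vertices is expressed through them. *)
Ltac separate :=
  repeat match goal with
  | H : is_true (~~ (@eq_op _ (tri _ _ _) (tri _ _ _))) |- _ =>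
    move/tri_neq: H
  end;
  repeat match goal with
  | Hx : is_true (in_mem ?x (mem ?P)), Hy : is_true (~~ (in_mem ?y (mem ?P))) |- _ =>
    lazymatch goal with
    | _ : is_true (x != y) |- _ => fail
    | _ => have := mem_neq Hx Hy; intro
    end
  end.

(** Once every membership in an explicit set is a test x == y, splitting on the
undecided tests, after use of the known inequalities, leaves closed terms. *)
Ltac split_eqs :=
  rewrite ?eqxx /=;
  repeat match goal with
  | H : is_true (?x != ?y) |- context [?x == ?y] => rewrite (negPf H) /=
  | H : is_true (?x != ?y) |- context [?y == ?x] =>
    rewrite (eq_sym y x) (negPf H) /=
  end;
  match goal with
  | |- context [@eq_op _ ?x ?y] =>
    let E := fresh in case: (eqVneq x y) => E; [subst | ]; split_eqs
  | _ => done
  end.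

Ltac weigh := separate; rewrite ?wt_tri ?inE; split_eqs.

(** Proves that two vertices differ by looking at coordinate x. *)
Ltac distinct_at x := apply: (@diff_at _ _ _ x); rewrite !triE; separate; split_eqs.

(** * Every W is a face *)

Section Faces.
Variable q : nat.
Implicit Types (i j k l m n x y : 'I_q) (A P Q : {set 'I_q}).

Lemma Wset_sub P i : Wset P i \subset Nset q 3.
Proof. by apply/subsetP => c /WsetP[] *; apply: tri_in_Nset. Qed.

(** A vertex of W is exposed by its support, except for e_i + e_j + e_m when j
or m lies in P: then 2e_i + e_j or 2e_i + e_m has the same weight on the support,
but dropping i from it makes these two lighter, while no vertex supported
outside P contains both j and m.  A vertex outside W is exposed by its repeated
index if no vertex of W repeats it so often, and by its support otherwise. *)
Lemma Wset_scarf (k : fieldType) P i : i \in P -> Wset P i \in scarf q 3 k.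
Proof.
move=> iP; apply/scarfP; split=> [|a Na]; first exact: Wset_sub.
apply/exposedP; have [/WsetP Wa | nWa] := boolP (a \in Wset P i).
  case: Wa => [j jP ji | j m l jP mP lP jm jl ml | j m ij im jm].
  - by exists [set i; j] => [|b /WsetP[] *]; weigh.
  - by exists [set j; m; l] => [|b /WsetP[] *]; weigh.
  - have [jP | jP] := boolP (j \in P).
      by exists [set j; m] => [|b /WsetP[] *]; weigh.
    have [mP | mP] := boolP (m \in P).
      by exists [set j; m] => [|b /WsetP[] *]; weigh.
    by exists [set i; j; m] => [|b /WsetP[] *]; weigh.
have : notW_spec P i a by apply: notWP.
case=> [j l ji | l /orP[/eqP -> | lP] | x m l xP xi mi li xm xl ml].
- by exists [set j] => [|b /WsetP[] *]; weigh.
- by exists [set i] => [|b /WsetP[] *]; weigh.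
- by exists [set i; l] => [|b /WsetP[] *]; weigh.
by exists [set x; m; l] => [|b /WsetP[] *]; weigh.
Qed.

(** * Maximality *)

Lemma card_outside P : #|P| + 3 <= q -> 2 < #|~: P|.
Proof.
have cPC : #|P| + #|~: P| = q by rewrite cardsC card_ord.
by rewrite -[X in _ <= X]cPC leq_add2l.
Qed.

Lemma has_outside P : #|P| + 3 <= q -> exists j, j \notin P.
Proof.
move=> /card_outside cardP; have /card_gt0P[j] : 0 < #|~: P| by apply: leq_trans cardP.
by rewrite inE => jP; exists j.
Qed.

Lemma three_outside P j : #|P| + 3 <= q -> j \notin P ->
  exists l m, [/\ l \notin P, m \notin P, j != l, j != m & l != m].
Proof.
move=> cardP jP.
have : 1 < #|~: P :\ j|.
  by move: (card_outside cardP); rewrite (cardsD1 j) in_setC jP.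
case/card_gt1P=> l [m [+ + lm]]; rewrite !inE => /andP[lj lP] /andP[mj mP].
by exists l, m; rewrite lP mP ![j == _]eq_sym lj mj lm.
Qed.

Lemma third_index i j : 3 <= q -> exists m, i != m /\ j != m.
Proof.
move=> q3; have : 0 < #|~: [set i; j]|.
  by have := cardsC [set i; j]; rewrite card_ord cards2; case: eqP => _; lia.
case/card_gt0P=> m; rewrite !inE negb_or => /andP[mi mj].
by exists m; rewrite ![_ == m]eq_sym.
Qed.

(** With a third index n outside P, the three vertices obtained from
e_i + e_j + e_l by replacing one index by n are in W.  Each must be lighter, so
n is not in A and the replaced index is. *)
Lemma exposing_outside P i j l A : i \in P -> #|P| + 3 <= q ->
  j \notin P -> l \notin P -> j != l ->
  exposes A (Wset P i) (tri i j l) ->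
  [/\ i \in A, j \in A & l \in A].
Proof.
move=> iP cardP jP lP jl expA.
have [n [nP jn ln]] : exists n, [/\ n \notin P, j != n & l != n].
  have [n [m [nP mP jn jm nm]]] := three_outside cardP jP.
  have [eln | nln] := eqVneq l n; last by exists n.
  by exists m; rewrite mP jm eln nm.
have ij := mem_neq iP jP; have il := mem_neq iP lP; have inn := mem_neq iP nP.
have W_in : tri i l n \in Wset P i by apply/WsetP/Wthrough.
have W_jn : tri i j n \in Wset P i by apply/WsetP/Wthrough.
have W_out : tri j l n \in Wset P i by apply/WsetP/Woutside.
have lt1 : wt (tri i l n) A < wt (tri i j l) A by apply: expA => //; distinct_at n.
have lt2 : wt (tri i j n) A < wt (tri i j l) A by apply: expA => //; distinct_at n.
have lt3 : wt (tri j l n) A < wt (tri i j l) A by apply: expA => //; distinct_at n.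
by move: lt1 lt2 lt3; rewrite !wt_tri; do 4 case: (_ \in A).
Qed.

(** The competitor 2e_i + e_j is obtained by replacing m by i, so A must
contain m and avoid i. *)
Lemma exposing_through P i j m A : i \in P -> j \in P -> i != j -> i != m ->
  exposes A (Wset P i) (tri i j m) ->
  j != m -> i \notin A /\ m \in A.
Proof.
move=> iP jP ij im expA jm.
have : wt (tri i i j) A < wt (tri i j m) A.
  apply: expA; last by distinct_at m.
  by apply/WsetP/Wdouble; rewrite // eq_sym.
by rewrite !wt_tri; do 3 case: (_ \in A).
Qed.

(** To force j into A as well, m is chosen so that some other index can replace
j in e_i + e_j + e_m without leaving W: if P misses enough indices, m and the
replacement are both taken outside P; if P is everything, the replacement is
i. *)
Lemma exposing_partner P i j : i \in P -> j \in P -> i != j ->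
  #|P| + 3 <= q \/ P = setT /\ 3 <= q ->
  exists m, [/\ i != m, j != m & forall A,
    exposes A (Wset P i) (tri i j m) ->
    [/\ i \notin A, j \in A & m \in A]].
Proof.
move=> iP jP ij [cardP | [PT q3]].
  have [m mP] := has_outside cardP.
  have [n [_ [nP _ mn _ _]]] := three_outside cardP mP.
  have im := mem_neq iP mP; have jm := mem_neq jP mP.
  have inn := mem_neq iP nP; have jn := mem_neq jP nP.
  exists m; split=> // A expA.
  have [iA mA] := exposing_through iP jP ij im expA jm; split=> //.
  have : wt (tri i m n) A < wt (tri i j m) A.
    by apply: expA; [apply/WsetP/Wthrough | distinct_at n].
  by rewrite !wt_tri; do 4 case: (_ \in A).
have [m [im jm]] := third_index i j q3.
exists m; split=> // A expA.
have [iA mA] := exposing_through iP jP ij im expA jm; split=> //.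
move: expA; rewrite triAC => expA.
by have [] := exposing_through iP _ im ij expA _; rewrite ?PT ?inE // eq_sym.
Qed.

(** For each kind of vertex b outside W, the vertex of W that blocks b is
chosen so that the indices forced into its exposing sets already give b enough
weight. *)
Lemma Wset_facet (k : fieldType) P i : i \in P ->
  #|P| + 3 <= q \/ P = setT /\ 3 <= q -> facet (scarf q 3 k) (Wset P i).
Proof.
move=> iP cardP; apply: scarf_facet; first exact: Wset_scarf.
move=> b Nb nWb; have : notW_spec P i b by apply: notWP.
case=> [j m ji | m mi_P | x m l xP xi mi li xm xl ml].
- have ij : i != j by rewrite eq_sym.
  have [jP | jP] := boolP (j \in P).
    (* 2e_j + e_i and 3e_j provide no third index, so one has to be chosen. *)
    have [mij | ] := boolP ((m == i) || (m == j)).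
      have [n [inn jn expA]] := exposing_partner iP jP ij cardP.
      exists (tri i j n) => [|A /expA[iA jA nA]]; first by apply/WsetP/Wthrough.
      by rewrite !wt_tri (negPf iA) jA nA; case: (_ \in A).
    rewrite negb_or ![m == _]eq_sym => /andP[im jm].
    exists (tri i j m) => [|A expA]; first by apply/WsetP/Wthrough.
    have [iA mA] := exposing_through iP jP ij im expA jm.
    by rewrite !wt_tri (negPf iA) mA; case: (_ \in A).
  have {}cardP : #|P| + 3 <= q by case: cardP => // -[PT _]; rewrite PT inE in jP.
  have [/andP[mP mi] | mPi] := boolP ((m \in P) && (m != i)).
    have mj := mem_neq mP jP; rewrite eq_sym in mi.
    exists (tri i m j) => [|A expA]; first by apply/WsetP/Wthrough.
    have [iA jA] := exposing_through iP mP mi ij expA mj.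
    by rewrite !wt_tri (negPf iA) jA; case: (_ \in A).
  (* With l chosen so, 2e_j + e_m has weight 3 on every set containing i, j, l. *)
  have [l [lP jl ml]] : exists l, [/\ l \notin P, j != l & m \in [:: i; j; l]].
    have [l [_ [lP _ jl _ _]]] := three_outside cardP jP.
    have [mij | ] := boolP (m \in [:: i; j]).
      by exists l; split; move: mij; rewrite // !inE orbA => ->.
    rewrite !inE negb_or => /andP[mi mj]; exists m; rewrite eq_sym mj.
    by move: mPi; rewrite mi andbT !inE eqxx !orbT => ->.
  exists (tri i j l) => [|A expA].
    by apply/WsetP/Wthrough => //; apply: mem_neq iP lP.
  have [iA jA lA] := exposing_outside iP cardP jP lP jl expA.
  rewrite !wt_tri iA jA lA.
  by move: ml; rewrite !inE => /or3P[] /eqP->; rewrite ?iA ?jA ?lA.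
- case: cardP => [cardP | [PT q3]].
    have [j jP mij] : exists2 j, j \notin P & m \in [:: i; j].
      case/orP: mi_P => [mi | mP]; last by exists m; rewrite // !inE eqxx orbT.
      by have [j jP] := has_outside cardP; exists j; rewrite // !inE mi.
    have [l [_ [lP _ jl _ _]]] := three_outside cardP jP.
    exists (tri i j l) => [|A expA].
      by apply/WsetP/Wthrough; rewrite // (mem_neq iP).
    have [iA jA lA] := exposing_outside iP cardP jP lP jl expA.
    rewrite !wt_tri iA jA lA.
    by move: mij; rewrite !inE => /orP[] /eqP->; rewrite ?iA ?jA.
  have {mi_P} -> : m = i by move: mi_P; rewrite PT inE orbF => /eqP.
  have [j [ij _]] := third_index i i q3.
  have [l [il jl]] := third_index i j q3.
  exists (tri i i j) => [|A expA].
    by apply/WsetP/Wdouble; rewrite ?PT ?inE // eq_sym.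
  have : wt (tri i j l) A < wt (tri i i j) A.
    by apply: expA; [apply/WsetP/Wthrough | distinct_at l].
  by rewrite !wt_tri; do 3 case: (_ \in A).
- rewrite eq_sym in xi; rewrite eq_sym in mi.
  exists (tri i x m) => [|A expA]; first by apply/WsetP/Wthrough.
  have [iA mA] := exposing_through iP xP xi mi expA xm.
  by rewrite !wt_tri (negPf iA) mA; case: (_ \in A) => //; case: (_ \in A).
Qed.

(** * The sets W and the sets U *)

Lemma Wset_sub_Uset P i : q < #|P| + 3 -> Wset P i \subset Uset 3 U_(i)%MM.
Proof.
move=> cardP; apply/subsetP => c Wc; rewrite inE (subsetP (Wset_sub P i)) //=.
apply/forallP => x; rewrite mnm1E.
case/WsetP: Wc => [j _ ji | j k l jP kP lP jk jl kl | j k ij ik jk]; rewrite ?triE.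
- by split_eqs.
- have : #|[set j; k; l]| <= #|~: P|.
    by apply/subset_leq_card/subsetP => y; rewrite !inE => /orP[/orP[]|] /eqP->.
  rewrite -(leq_add2l #|P|) cardsC card_ord [[set j; k; l]]setUC !cardsU1 cards1.
  by rewrite !inE negb_or eq_sym jl eq_sym kl jk leqNgt cardP.
by split_eqs.
Qed.

Lemma Uset_unit i : Uset 3 U_(i)%MM = Wset setT i.
Proof.
apply/eqP; rewrite eqEsubset Wset_sub_Uset ?andbT ?cardsT ?card_ord; last lia.
apply/subsetP => c; rewrite inE => /andP[Nc /forallP Uc].
apply/negPn/negP => nWc; have : notW_spec setT i c by apply: notWP => //; rewrite inE.
move: Uc => /[swap]; case=> [j m ji | m mi | x m l _ xi mi li xm xl ml] Uc.
- by have := Uc j; rewrite mnm1E triE; split_eqs.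
- rewrite inE orbF in mi; rewrite (eqP mi) in Uc.
  by have := Uc i; rewrite mnm1E triE; split_eqs.
by have := Uc i; rewrite mnm1E triE; split_eqs.
Qed.

Lemma Uset_zero i : Uset 3 (0%MM : 'X_{1..q}) = Wset [set i] i.
Proof.
have iP : i \in [set i] by rewrite inE.
apply/setP => c; apply/idP/idP => [|Wc].
  rewrite inE => /andP[Nc /forallP Uc]; apply/negPn/negP => nWc.
  have : notW_spec [set i] i c by apply: notWP.
  move: Uc => /[swap]; case=> [j m ji | m _ | x m l xP xi mi li xm xl ml] Uc.
  - by have := Uc j; rewrite mnm0E triE; split_eqs.
  - by have := Uc i; rewrite mnm0E triE; split_eqs.
  by rewrite inE (negPf xi) in xP.
rewrite inE (subsetP (Wset_sub [set i] i)) //=; apply/forallP => x; rewrite mnm0E.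
case/WsetP: Wc => [j jP ji | j k l _ _ _ jk jl kl | j k ij ik jk]; rewrite ?triE.
- by rewrite inE (negPf ji) in jP.
- by split_eqs.
by split_eqs.
Qed.

Lemma Wset_notin_Ucomplex P i : i \in P -> 2 <= #|P| -> #|P| + 3 <= q ->
  Wset P i \notin Ucomplex q 3.
Proof.
move=> iP P2 cardP; rewrite inE; apply/existsP => -[a /andP[_ /subsetP sub]].
have [j jP ji] : exists2 j, j \in P & j != i.
  have /card_gt0P[j] : 0 < #|P :\ i| by move: P2; rewrite (cardsD1 i) iP.
  by rewrite !inE => /andP[ji jP]; exists j.
have [x xP] := has_outside cardP.
have [y [z [yP zP xy xz yz]]] := three_outside cardP xP.
have in_box c : c \in Wset P i -> a i <= c i <= (a i).+1.
  by move=> /sub; rewrite inE => /andP[_ /forallP].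
have /in_box : tri i i j \in Wset P i by apply/WsetP/Wdouble.
have /in_box : tri x y z \in Wset P i by apply/WsetP/Woutside.
rewrite !triE eqxx (negPf ji) !(eq_sym _ i).
rewrite (negPf (mem_neq iP xP)) (negPf (mem_neq iP yP)) (negPf (mem_neq iP zP)).
by case: (a i : nat) => [|n]; rewrite ?andbF.
Qed.

(** These memberships recover i and P minus i from W. *)
Lemma double_in_Wset P i x y : x != y ->
  (tri x x y \in Wset P i) = [&& x == i, y \in P & y != i].
Proof.
move=> xy; apply/idP/and3P => [/WsetP Wc | [/eqP-> yP yi]]; last by apply/WsetP/Wdouble.
pose coord (z : 'I_q) (c : 'X_{1..q < 4}) := c z.
have : coord x (tri x x y) = 2 by rewrite /coord triE eqxx eq_sym (negPf xy).
have : coord y (tri x x y) = 1 by rewrite /coord triE eqxx (negPf xy).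
case: Wc => [j jP ji | j k l _ _ _ jk jl kl | j k ij ik jk]; rewrite /coord !triE.
- have [ix | ix] := eqVneq i x; last by case: (j == x).
  rewrite -ix in xy *; rewrite (negPf xy) ?eqxx.
  by case: eqVneq => [<- |].
- by split_eqs.
by split_eqs.
Qed.

Lemma Wset_inj P Q i j : i \in P -> j \in Q -> 2 <= #|P| ->
  Wset P i = Wset Q j -> P = Q /\ i = j.
Proof.
move=> iP jQ P2 eqW.
have [x xP xi] : exists2 x, x \in P & x != i.
  have /card_gt0P[x] : 0 < #|P :\ i| by move: P2; rewrite (cardsD1 i) iP.
  by rewrite !inE => /andP[xi xP]; exists x.
have eij : i = j.
  have : tri i i x \in Wset Q j by rewrite -eqW double_in_Wset ?eqxx ?xP // eq_sym.
  by rewrite double_in_Wset 1?eq_sym // => /andP[/eqP].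
split=> //; rewrite -{}eij in jQ eqW; apply/setP => y.
have [-> | yi] := eqVneq y i; first by rewrite iP jQ.
have := congr1 (fun W : {set 'X_{1..q < 4}} => tri i i y \in W) eqW.
by rewrite !double_in_Wset 1?[i == y]eq_sym // eqxx yi !andbT.
Qed.
End Faces.

Theorem proposition5p2 (k : fieldType) (q : nat) (hq : (0 < q)%N) :
  (forall (P : {set 'I_q}) (i : 'I_q), i \in P ->
    [/\ #|P| = 1%N ->
          Wset P i = Uset 3 (0%MM : 'X_{1..q}) /\
          ((4 <= q)%N -> facet (scarf q 3 k) (Uset 3 (0%MM : 'X_{1..q}))),
        (2 <= #|P|)%N -> (#|P| + 3 <= q)%N ->
          facet (scarf q 3 k) (Wset P i) /\ Wset P i \notin Ucomplex q 3
      & (q < #|P| + 3)%N ->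
          [/\ Wset P i \in scarf q 3 k,
              Wset P i \subset Uset 3 U_(i)%MM
            & (3 <= q)%N -> facet (scarf q 3 k) (Uset 3 U_(i)%MM)]])
  /\
  (forall (P Q : {set 'I_q}) (i j : 'I_q), i \in P -> j \in Q ->
    (2 <= #|P|)%N -> (#|P| + 3 <= q)%N ->
    (2 <= #|Q|)%N -> (#|Q| + 3 <= q)%N ->
    Wset P i = Wset Q j -> P = Q /\ i = j).
Proof.
split=> [P i iP | P Q i j iP jQ P2 _ _ _]; last exact: Wset_inj.
split=> [/eqP/cards1P[x Px] | P2 cardP | cardP].
- have {x}Px : P = [set i] by move: iP; rewrite Px inE => /eqP->.
  rewrite (Uset_zero i) Px; split=> // q4.
  by apply: Wset_facet; rewrite ?inE // cards1; left.
- by split; [apply: Wset_facet; [|left] | apply: Wset_notin_Ucomplex].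
split; [exact: Wset_scarf | exact: Wset_sub_Uset | move=> q3].
by rewrite Uset_unit; apply: Wset_facet; [rewrite inE | right].
Qed.
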